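(* Let $r,d$ be positive integers and let $A$ be an arrangement of at least $(r-1)(d+1)+1$ hyperplanes in $\mathbb{R}^d$. Then there exist a point $q\in\mathbb{R}^d$ and a partition of $A$ into $r$ parts $A_1,\dots,A_r$ such that $\mathrm{RD}(A_j,q)\geq 1$ for every $j=1,\dots,r$.
   Context: A hyperplane arrangement is a finite set of affine hyperplanes in $\mathbb{R}^d$. For an arrangement $A$ and a query point $q\in\mathbb{R}^d$, the regression depth $\mathrm{RD}(A,q)$ is the minimum, over all (closed) rays emanating from $q$, of the number of hyperplanes of $A$ that the ray intersects or is parallel to. In particular, if $q$ lies on a hyperplane $h$, every ray from $q$ intersects $h$. *)

(* Defs.v *)
From HB Require Import structures.
From mathcomp Require Import all_boot all_order all_algebra.
From mathcomp Require Import boolp reals.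
Set Implicit Arguments. Unset Strict Implicit. Unset Printing Implicit Defensive.
Import Order.TTheory GRing.Theory Num.Theory.
Local Open Scope ring_scope.

Definition dotp {R : realType} {d : nat} (u v : 'rV[R]_d) : R :=
  \sum_(k < d) u 0 k * v 0 k.

(* An arrangement of n hyperplanes in R^d: hyperplane i is
   { x | dotp (a i) x = b i } with a i <> 0, and distinct indices give
   distinct hyperplanes (as point sets), so it is a genuine set. *)
Definition on_hyp {R : realType} {d n : nat} (a : 'I_n -> 'rV[R]_d)
  (b : 'I_n -> R) (i : 'I_n) (x : 'rV[R]_d) : Prop := dotp (a i) x = b i.

Definition arrangement {R : realType} {d n : nat} (a : 'I_n -> 'rV[R]_d)
  (b : 'I_n -> R) : Prop :=
  (forall i, a i != 0) /\
  (forall i j, (forall x, on_hyp a b i x <-> on_hyp a b j x) -> i = j).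

Definition ray_meets {R : realType} {d n : nat} (a : 'I_n -> 'rV[R]_d)
  (b : 'I_n -> R) (q v : 'rV[R]_d) (i : 'I_n) : Prop :=
  (exists t : R, 0 <= t /\ on_hyp a b i (q + t *: v)) \/ dotp (a i) v = 0.

Definition ray_count {R : realType} {d n : nat} (a : 'I_n -> 'rV[R]_d)
  (b : 'I_n -> R) (S : {set 'I_n}) (q v : 'rV[R]_d) : nat :=
  #|[set i in S | `[< ray_meets a b q v i >] ]|.

(* RD(S, q) >= k : the minimum over all rays from q of ray_count is >= k,
   i.e. every ray from q meets at least k hyperplanes of S. *)
Definition RD_ge {R : realType} {d n : nat} (a : 'I_n -> 'rV[R]_d)
  (b : 'I_n -> R) (S : {set 'I_n}) (q : 'rV[R]_d) (k : nat) : Prop :=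
  forall v : 'rV[R]_d, v != 0 -> (k <= ray_count a b S q v)%N.

(* Main.v *)
(* For [q] let [c_i = b_i - <a_i, q>]; a part [S] has depth at least 1 at [q] if
   some [c_i] with [i] in [S] vanishes, or if the vectors [c_i a_i], [i] in [S],
   contain 0 in their convex hull. For weights [mu] in the simplex, consider
   the linear program that splits the weight of every hyperplane among the
   [r] parts and the two signs so that every part has weight [1 / r] and is a
   balanced combination of signed normals, and maximizes the sum of the signed
   [b_i] (the dual of weighted least absolute deviations). Its dual solution
   is a point [q] with the signs prescribed by the weights. Only the right-hand
   side depends on [mu], so the optimum with lexicographic tie-breaking is
   continuous in [mu]; by a dimension count, at this optimum some hyperplane is
   used with each sign by at most one part. A KKM argument, based on
   Scarf's lemma, gives a [mu] at which this holds for all hyperplanes. A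
   hyperplane that is then used by two parts has two signs, hence contains
   [q]: it can form a part alone, after the two parts are merged so that it
   cancels. *)
Require Import Defs.
From HB Require Import structures.
From mathcomp Require Import boolp classical_sets reals topology normedtype.
From mathcomp Require Import all_boot all_order all_algebra.
From mathcomp Require Import zify ring lra.
Set Implicit Arguments. Unset Strict Implicit. Unset Printing Implicit Defensive.
Import Order.TTheory GRing.Theory Num.Theory.
Import numFieldNormedType.Exports.
Local Open Scope nat_scope.

(** * Scarf's lemma *)

(** Scarf's dominating sets: no [y] exceeds the minima of [S] in all orders at once. *)
Definition dominant (Y I : finType) (rk : I -> Y -> nat) (S : {set Y}) : bool :=
  [forall y, exists i, forall s in S, rk i y <= rk i s].

Lemma dominantP (Y I : finType) (rk : I -> Y -> nat) (S : {set Y}) :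
  reflect (forall y, exists i, forall s, s \in S -> rk i y <= rk i s)
          (dominant rk S).
Proof.
apply: (iffP forallP) => H y.
  by have /existsP[i /forall_inP Hi] := H y; exists i.
by have [i Hi] := H y; apply/existsP; exists i; apply/forall_inP.
Qed.

Lemma dominant_sub (Y I : finType) (rk : I -> Y -> nat) (S S' : {set Y}) :
  S' \subset S -> dominant rk S -> dominant rk S'.
Proof.
move=> /subsetP sS /dominantP dS; apply/dominantP => y.
by have [i Hi] := dS y; exists i => s /sS; apply: Hi.
Qed.

(** Dominance applied to an element of [S] itself gives an order in which it is the minimum of [S];
    so [m] maps onto [S]. *)
Lemma dominant_minima (Y I : finType) (rk : I -> Y -> nat) (S : {set Y}) :
    (forall i, injective (rk i)) -> dominant rk S -> S != set0 ->
  exists m : I -> Y, [/\ forall i, m i \in S,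
    forall i s, s \in S -> rk i (m i) <= rk i s
    & forall s, s \in S -> exists i, m i = s].
Proof.
move=> inj /dominantP dS /set0Pn[s0 Ss0].
exists (fun i => [arg min_(s < s0 in S) rk i s]); split.
- by move=> i; case: arg_minnP.
- by move=> i s Ss; case: arg_minnP => // t St; apply.
- move=> s Ss; have [i Hi] := dS s; exists i.
  case: arg_minnP => // t St Ht; apply: (inj i); apply/eqP.
  by rewrite eqn_leq Ht //= Hi.
Qed.

Definition above (Y I : finType) (rk : I -> Y -> nat) (m : I -> Y) i y : bool :=
  [forall k, (k != i) ==> (rk k (m k) < rk k y)].

(** With [m] the minima of a dominant set, this is the only candidate to become the new minimum in
    order [i] once a point is added. *)
Definition topmost (Y I : finType) (rk : I -> Y -> nat) (m : I -> Y) i y : bool :=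
  above rk m i y && [forall z, above rk m i z ==> (rk i z <= rk i y)].

(** Scarf's pivot step. There is one order more than there are points, so two orders share a
    minimum; a new point has to take over exactly one of these two, and dominance forces it to be
    topmost there. *)
Lemma dominant_extensions (Y I : finType) (rk : I -> Y -> nat) (S : {set Y}) :
    (forall i, injective (rk i)) -> dominant rk S -> #|S|.+1 = #|I| ->
    S != set0 ->
  exists (m : I -> Y) (i1 i2 : I),
    [/\ forall i s, s \in S -> rk i (m i) <= rk i s,
        forall i, m i \in S,
        i1 != i2, m i1 = m i2 &
        forall y, (y \notin S) && dominant rk (y |: S) =
          topmost rk m i1 y || topmost rk m i2 y].
Proof.
move=> inj dS cS S0; have [m [mS mle msurj]] := dominant_minima inj dS S0.
have /dominantP dS' := dS.
have [i1 [i2 [ne12 eq12]]] : exists i1 i2, i1 != i2 /\ m i1 = m i2.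
  have : ~~ injectiveb m.
    apply/negP => /injectiveP minj; have := card_imset [set: I] minj.
    rewrite cardsT -cS; apply/eqP; rewrite neq_ltn ltnS subset_leq_card //.
    by apply/subsetP => _ /imsetP[i _ ->].
  by case/injectivePn => i1 [i2 ne e]; exists i1, i2.
exists m, i1, i2; split => // y.
pose upper := above rk m; pose top := topmost rk m.
apply/andP/orP => [[yS dR]|].
  have R0 : y |: S != set0 by apply/set0Pn; exists y; rewrite setU11.
  have [m' [m'R m'le m'surj]] := dominant_minima inj dR R0.
  have cR : #|y |: S| = #|I| by rewrite cardsU1 yS -cS.
  have m'inj : injective m'.
    apply/injectiveP/card_uniqP; rewrite size_map -cardE.
    rewrite [RHS](_ : _ = #|I|) // -cR; apply: eq_card => s.
    apply/idP/idP => [/mapP[i _ ->] //|/m'surj[i <-]].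
    by apply/mapP; exists i; rewrite ?mem_enum.
  have [i m'i] : exists i, m' i = y by apply: m'surj; rewrite setU11.
  have m'k k : k != i -> m' k = m k /\ rk k (m k) < rk k y.
    move=> ki; have m'ky : m' k != y.
      by apply: contra ki => /eqP e; apply/eqP/m'inj; rewrite m'i.
    have m'kS : m' k \in S by have := m'R k; rewrite in_setU1 (negPf m'ky).
    have e : m' k = m k.
      by apply: (inj k); apply/eqP; rewrite eqn_leq mle // m'le // setU1r.
    split=> //; rewrite -e ltn_neqAle m'le ?setU11 // andbT.
    by apply: contra m'ky => /eqP /inj ->.
  have up : upper i y by apply/forallP => k; apply/implyP => /m'k[].
  have tp : top i y.
    rewrite /top /topmost -/upper up; apply/forallP => z;
      apply/implyP => /forallP uz.
    have [k Hk] := dominantP _ _ dR z.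
    have [<-|ki] := eqVneq k i; first by rewrite Hk ?setU11.
    have := uz k; rewrite ki /= ltnNge; apply: contraNT => _.
    by apply: Hk; rewrite setU1r.
  (* If [i] were neither [i1] nor [i2], the old minima would persist in both orders, against the
     injectivity of [m']. *)
  have [<-|n1] := eqVneq i i1; first by left.
  have [<-|n2] := eqVneq i i2; first by right.
  have [e1 _] := m'k i1 ltac:(by rewrite eq_sym).
  have [e2 _] := m'k i2 ltac:(by rewrite eq_sym).
  by move: ne12; rewrite (m'inj i1 i2) ?eqxx // e1 e2.
move=> tops; have [i [tpi other]] : exists i, top i y /\ exists2 k, k != i & m k = m i.
  case: tops => t; [exists i1|exists i2]; split=> //; [exists i2|exists i1] => //.
  by rewrite eq_sym.
have Sother s : s \in S -> exists2 k, k != i & m k = s.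
  move=> /msurj[k <-]; have [->|] := eqVneq k i => //; last by exists k.
have /andP[/forallP uy /forallP ty] := tpi.
split.
  apply/negP => /Sother[k ki mk]; have := uy k; by rewrite ki mk ltnn.
apply/dominantP => z; case: (boolP (upper i z)) => [uz|].
  exists i => s; rewrite in_setU1 => /orP[/eqP ->|Ss].
    by have /implyP := ty z; apply.
  have [k Hk] := dS' z; have [<-|ki] := eqVneq k i; first exact: Hk.
  by have /forallP/(_ k) := uz; rewrite ki /= ltnNge Hk.
rewrite negb_forall => /existsP[k]; rewrite negb_imply -leqNgt => /andP[ki Hk].
exists k => s; rewrite in_setU1 => /orP[/eqP ->|Ss].
  by have := uy k; rewrite ki /= => /ltnW; apply: leq_trans.
exact: leq_trans Hk (mle _ _ Ss).
Qed.

Lemma card_fibers (A B : finType) (F : {set A}) (f : A -> B) :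
  #|F| = \sum_b #|[set a in F | f a == b]|.
Proof.
rewrite -sum1_card (partition_big f predT) //=; apply: eq_bigr => b _.
by rewrite -sum1_card; apply: eq_bigl => a; rewrite inE.
Qed.

Lemma even_fibers (A B : finType) (F : {set A}) (f : A -> B) :
  (forall b, ~~ odd #|[set a in F | f a == b]|) -> ~~ odd #|F|.
Proof.
move=> H; rewrite (card_fibers F f) -dvdn2.
by apply: dvdn_sum => b _; rewrite dvdn2.
Qed.

Lemma odd_fibers (A B : finType) (F : {set A}) (f : A -> B) (b0 : B) :
  odd #|[set a in F | f a == b0]| ->
  (forall b, b != b0 -> ~~ odd #|[set a in F | f a == b]|) -> odd #|F|.
Proof.
move=> H0 H; rewrite (card_fibers F f) (bigD1 b0) //= oddD H0 /= -dvdn2.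
by apply: dvdn_sum => b /H; rewrite dvdn2.
Qed.

Lemma argmax_unique (Y : finType) (f : Y -> nat) (P : pred Y) (y0 : Y) :
    injective f -> P y0 ->
  exists t, forall y, P y && [forall z, P z ==> (f z <= f y)] = (y == t).
Proof.
move=> inj P0; case: (@arg_maxnP _ y0 P f P0) => t Pt tmax; exists t => y.
apply/andP/eqP => [[Py /forallP My]|->].
- apply: inj; apply/eqP; rewrite eqn_leq; apply/andP; split; first exact: tmax.
  by have := My t; rewrite Pt.
- by split=> //; apply/forallP => z; apply/implyP => /tmax.
Qed.

(** If removing [x] leaves each label but [i0] exactly once, then the label of [x] occurs at exactly
    one other [x'], and [x], [x'] are the only removals that work. *)
Lemma even_almost_complete_facets (Y I : finType) (lab : Y -> I) (i0 : I)
    (R : {set Y}) :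
    #|R| = #|I| -> lab @: R != [set: I] ->
  ~~ odd #|[set x in R | lab @: (R :\ x) == [set~ i0]]|.
Proof.
move=> cR nlab; set E := [set x in R | _].
have [E0|[x]] := set_0Vmem E; first by rewrite E0 cards0.
rewrite inE => /andP[xR /eqP ex].
have cx : #|R :\ x|.+1 = #|I| by rewrite -cR (cardsD1 x R) xR.
have inj : {in R :\ x &, injective lab}.
  apply/imset_injP; rewrite ex cardsC1; apply/eqP.
  by rewrite -cx.
have labR : lab @: R = lab x |: [set~ i0].
  by rewrite -(setD1K xR) imsetU1 ex.
have lx : lab x \in lab @: (R :\ x).
  rewrite ex !inE; apply: contra nlab => /eqP lx.
  by rewrite labR lx; apply/eqP/setP => k; rewrite !inE orbN.
have [x' x'R lx'] := imsetP lx.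
have xx' : x != x' by move: x'R; rewrite !inE eq_sym => /andP[].
suff -> : E = [set x; x'] by rewrite cards2 xx'.
apply/setP => z; rewrite !inE; apply/andP/orP => [[zR /eqP ez]|].
  have [_|zx] := eqVneq z x; first by left.
  have [_|zx'] := eqVneq z x'; first by right.
  have cz : #|lab @: (R :\ z)| = #|R :\ z|.
    by rewrite ez -ex card_in_imset //; apply: succn_inj;
      rewrite cx -cR (cardsD1 z R) zR.
  have /imset_injP zinj : #|lab @: (R :\ z)| == #|R :\ z| by rewrite cz.
  by move: xx'; rewrite (zinj x x') ?eqxx // !inE eq_sym ?zx ?zx' //;
    move: x'R; rewrite !inE => /andP[].
case=> /eqP ->; first by rewrite xR ex.
have x'R' : x' \in R by move: x'R; rewrite !inE => /andP[].
split=> //; apply/eqP; rewrite -ex; apply/setP => k; apply/imsetP/imsetP.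
  case=> u uR ->; have [->|ux] := eqVneq u x; first by exists x'.
  by exists u => //; move: uR; rewrite !inE ux => /andP[].
case=> u uR ->; have [->|ux'] := eqVneq u x'.
  by exists x => //; rewrite !inE xx'.
by exists u => //; move: uR; rewrite !inE ux' => /andP[].
Qed.

(* Scarf's lemma: the points are completed by one slack vector per index,
   lowest in its own order and above all points in the others, and the
   completely labelled dominant sets are counted modulo 2. *)
Lemma scarf (X I : finType) (x0 : X) (rk : I -> X -> nat) (c : X -> I) :
    (forall i, injective (rk i)) -> 1 < #|I| ->
  exists T : {set X}, T != set0 /\
    forall y, exists2 i, i \in c @: T & forall x, x \in T -> rk i y <= rk i x.
Proof.
move=> inj cI.
have /card_gt0P[i0 _] := ltnW cI.
pose B := (\max_i \max_x (rk i x)).+2.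
have ltB i x : (rk i x).+1 < B.
  rewrite /B !ltnS; apply: leq_trans (leq_bigmax (F := rk i) x) _.
  exact: (leq_bigmax (F := fun i => \max_x rk i x)).
pose Y := (X + I)%type.
(* Points are shifted by one to make room for the slack of [i] at 0; [enum_rank] keeps the other
   slacks, above all points, distinct. *)
pose rkY (i : I) (y : Y) := match y with
  | inl x => (rk i x).+1
  | inr k => if k == i then 0 else B + enum_rank k end.
pose lab (y : Y) := match y with inl x => c x | inr k => k end.
have injY i : injective (rkY i).
  move=> [x|k] [x'|k'] /=.
  - by case=> /inj ->.
  - by case: eqP => // _ e; have := ltB i x; rewrite e; lia.
  - by case: eqP => // _ e; have := ltB i x'; rewrite -e; lia.
  - case: eqP => [->|_]; case: eqP => [->|_] //; try by lia.
    by move/addnI/val_inj/enum_rank_inj => ->.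
have [|noroom] := boolP [exists R : {set Y},
    [&& dominant rkY R, #|R| == #|I| & lab @: R == [set: I]]].
  case/existsP=> R /and3P[/dominantP dR /eqP cR /eqP labR].
  have labinj : {in R &, injective lab}.
    by apply/imset_injP; rewrite labR cardsT cR.
  pose T := [set x | inl x \in R].
  (* The element of [R] with label [i] cannot be the slack of [i], whose rank 0 in order [i] lies
     below [y]; so it is a point coloured [i]. *)
  have key y : exists2 i, i \in c @: T & forall x, x \in T -> rk i y <= rk i x.
    have [i Hi] := dR (inl y); exists i.
      have : i \in lab @: R by rewrite labR.
      case/imsetP=> [[x|k] sR /= e]; first by rewrite e; apply: imset_f;
        rewrite inE.
      by have := Hi _ sR; rewrite /= e eqxx.
    by move=> x; rewrite inE => /Hi.
  exists T; split=> //; apply/set0Pn.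
  by have [i /imsetP[x xT _] _] := key x0; exists x.
exfalso.
pose S0 : {set Y} := [set inr k | k in [set~ i0]].
(* Pairs of a dominant set and an element whose removal leaves exactly the labels other than [i0].
   Grouped by the set their number is even; grouped by the remaining facet it is odd, as [S0] has
   one extension and every other facet two. *)
pose Fl := [set p : {set Y} * Y | [&& p.2 \in p.1, dominant rkY p.1,
   #|p.1| == #|I| & lab @: (p.1 :\ p.2) == [set~ i0]]].
have even : ~~ odd #|Fl|.
  apply: (even_fibers (f := fst)) => R.
  have [-> |[p0]] := set_0Vmem [set p in Fl | p.1 == R]; first by rewrite cards0.
  rewrite !inE => /andP[/and4P[_ dR cR _] /eqP e]; rewrite e in dR cR.
  rewrite (_ : [set p in Fl | p.1 == R] =
      [set (R, x) | x in [set x in R | lab @: (R :\ x) == [set~ i0]]]).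
    rewrite card_imset; last by move=> x x' [].
    apply: even_almost_complete_facets; first exact/eqP.
    apply: contra noroom => /eqP labR; apply/existsP; exists R.
    by rewrite dR cR labR eqxx.
  apply/setP => -[R' x]; rewrite !inE /=; apply/idP/imsetP.
    by case/andP => /and4P[xR _ _ lx] /eqP e'; exists x; rewrite ?inE -e' ?xR.
  by case=> x'; rewrite inE => /andP[xR lx] [-> ->]; rewrite xR dR cR lx eqxx.
have fibE (S : {set Y}) : lab @: S = [set~ i0] -> #|S|.+1 = #|I| ->
   #|[set p in Fl | p.1 :\ p.2 == S]| =
   #|[set y | (y \notin S) && dominant rkY (y |: S)]|.
  move=> labS cS; rewrite -(card_imset (f := fun y => (y |: S, y)));
    last by move=> y y' [].
  congr #|pred_of_set _|; apply/setP => -[R y]; rewrite !inE /=; apply/idP/imsetP.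
    case/andP=> /and4P[yR dR cR _] /eqP e.
    by exists y; rewrite ?inE -e ?setD1K // !inE eqxx.
  case=> y'; rewrite inE => /andP[yS dR] [-> ->].
  by rewrite setU11 dR cardsU1 yS add1n cS eqxx setU1K // labS !eqxx.
have cardS (S : {set Y}) : lab @: S = [set~ i0] -> #|S|.+1 = #|I| -> S != set0.
  by move=> _ cS; rewrite -card_gt0 -ltnS cS.
have S0lab : lab @: S0 = [set~ i0].
  by rewrite -imset_comp (eq_imset (g := id)) ?imset_id.
have S0card : #|S0|.+1 = #|I|.
  rewrite card_imset; last by move=> k k' [].
  by rewrite cardsC1 prednK // ltnW.
have : odd #|Fl|.
  apply: (odd_fibers (f := fun p => p.1 :\ p.2) (b0 := S0)).
    rewrite (fibE _ S0lab S0card).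
    have dS0 : dominant rkY S0.
      apply/dominantP => -[x|k]; last by exists k => s _; rewrite /= eqxx.
      exists i0 => s /imsetP[k]; rewrite !inE => /negPf ki -> /=.
      by rewrite ki (leq_trans (ltnW (ltB _ _))) // leq_addr.
    have [m [i1 [i2]]] := dominant_extensions injY dS0 S0card (cardS _ S0lab S0card).
    move=> [mle mS ne12 e12 ext].
    pose upper := above rkY m; pose top := topmost rkY m.
    have mk k : k != i0 -> m k = inr k.
      move=> ki; apply: (injY k); apply/eqP; rewrite eqn_leq.
      rewrite mle /=; first by rewrite eqxx.
      by apply/imsetP; exists k; rewrite ?inE.
    have up0 : upper i0 (inl x0).
      by apply/forallP => k; apply/implyP => ki; rewrite mk //= eqxx.
    have [t Ht] := argmax_unique (injY i0) up0.
    (* Such a [y] would have to exceed the slack of [k1] in order [i0], hence be a slack other than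
       that of [i0]; but that slack is lowest in its own order. *)
    have notop k1 : k1 != i0 -> m i0 = m k1 -> forall y, top k1 y = false.
      move=> k1i0 mk1 y; apply/negP => /andP[/forallP uy _].
      have := uy i0; rewrite eq_sym k1i0 mk1 mk //= (negPf k1i0).
      case: y uy => [x|k'] uy; first by rewrite ltnNge (leq_trans (ltnW (ltB _ _))) // leq_addr.
      have [->|k'i0] := eqVneq k' i0; first by rewrite /= eqxx.
      rewrite /= (negPf k'i0) => lt; have := uy k'.
      by rewrite (mk k') // ltnn implybF negbK => /eqP e; rewrite e ltnn in lt.
    suff -> : [set y | (y \notin S0) && dominant rkY (y |: S0)] = [set t] by rewrite cards1.
    apply/setP => y; rewrite !inE ext -/(top i1 y) -/(top i2 y).
    have [e1|n1] := eqVneq i1 i0.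
      rewrite (notop i2) ?orbF -?e12 ?e1 //; first by rewrite /top /topmost Ht.
      by rewrite eq_sym -e1.
    have [e2|n2] := eqVneq i2 i0; last first.
      by move: e12; rewrite !mk // => -[e]; rewrite e eqxx in ne12.
    by rewrite (notop i1) ?orFb -?e12 ?e12 ?e2 // /top /topmost Ht.
  move=> S SS0.
  have [-> |[p0]] := set_0Vmem [set p in Fl | p.1 :\ p.2 == S];
    first by rewrite cards0.
  rewrite !inE => /andP[/and4P[yR dR cR /eqP labS] /eqP e].
  rewrite e in labS.
  have cS : #|S|.+1 = #|I| by rewrite -(eqP cR) (cardsD1 p0.2 p0.1) yR e.
  have dS : dominant rkY S by apply: dominant_sub dR; rewrite -e subD1set.
  rewrite fibE //.
  have [x1 x1S] : exists x1, inl x1 \in S.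
    have [/existsP//|no] := boolP [exists x1, inl x1 \in S].
    case/negP: SS0; rewrite eqEcard -ltnS cS S0card leqnn andbT.
    apply/subsetP => -[x|k] kS; first by move/existsPn: no => /(_ x); rewrite kS.
    by apply/imset_f; rewrite -labS; apply/imsetP; exists (inr k).
  have [m [i1 [i2]]] := dominant_extensions injY dS cS (cardS _ labS cS).
  move=> [mle mS ne12 e12 ext].
    pose upper := above rkY m; pose top := topmost rkY m.
  (* In every other order this slack lies above the point [x1], hence above the minimum; so both
     shared orders have a topmost element. *)
  have up i : upper i (inr i).
    apply/forallP => k; apply/implyP => ki /=; rewrite eq_sym (negPf ki).
    by rewrite (leq_ltn_trans (mle k _ x1S)) // (leq_trans (ltB _ _)) // leq_addr.
  have [t1 Ht1] := argmax_unique (injY i1) (up i1).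
  have [t2 Ht2] := argmax_unique (injY i2) (up i2).
  suff -> : [set y | (y \notin S) && dominant rkY (y |: S)] = [set t1; t2].
    rewrite cards2; suff -> : t1 != t2 by [].
    apply/eqP => e12t.
    have /andP[/forallP u1 _] : top i1 t1 by rewrite /top /topmost Ht1.
    have /andP[/forallP u2 _] : top i2 t1 by rewrite /top /topmost Ht2 e12t.
    have [k Hk] := dominantP _ _ dS t1.
    have := Hk _ (mS k); rewrite leqNgt => /negP; apply.
    have [ki1|ki1] := eqVneq k i1; last by have := u1 k; rewrite ki1.
    by have := u2 k; rewrite ki1 ne12.
  by apply/setP => y; rewrite !inE ext /topmost Ht1 Ht2.
by rewrite (negPf even).
Qed.

(** * Scarf's lemma on the grid points of the simplex *)

Definition grid (n K : nat) := {x : {ffun 'I_n -> 'I_K.+1} | \sum_i x i == K}.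

Lemma grid_above (n K : nat) (g : 'I_n -> nat) (i0 : 'I_n) :
  \sum_i g i <= K -> exists y : grid n K, forall i, g i <= val y i.
Proof.
move=> gK; pose h i := g i + (K - \sum_i g i) * (i == i0).
have e1 : \sum_(i < n) (i == i0 : nat) = 1.
  by rewrite (bigD1 i0) //= eqxx big1 // => i /negPf ->.
have hsum : \sum_i h i = K.
  by rewrite big_split /= -big_distrr /= e1 muln1 subnKC.
have hK i : h i < K.+1 by rewrite ltnS -hsum (bigD1 i) //= leq_addr.
pose y : {ffun 'I_n -> 'I_K.+1} := [ffun i => Ordinal (hK i)].
have ysum : \sum_i y i == K.
  by apply/eqP; rewrite -[RHS]hsum; apply: eq_bigr => i _; rewrite ffunE.
by exists (exist _ y ysum) => i; rewrite /= ffunE /= leq_addr.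
Qed.

(** Order [i] compares coordinate [i], with ties broken by enumeration. By Scarf's lemma no grid
    point exceeds the minima of [T] in all coordinates whose colour occurs, so these minima nearly
    exhaust the total [K], and little freedom remains within [T]. *)
Lemma scarf_grid (n K : nat) (c : grid n K -> 'I_n) : 1 < n ->
  exists T : {set grid n K}, [/\ T != set0,
    forall i x, i \notin c @: T -> x \in T -> val x i < n
    & forall i x x', x \in T -> x' \in T -> val x i < val x' i + n].
Proof.
move=> n1; pose i0 : 'I_n := Ordinal (ltnW n1).
have [x0 _] : exists x : grid n K, forall i, 0 <= val x i.
  by apply: (grid_above i0 (g := fun=> 0)); rewrite big1.
pose rk (i : 'I_n) (x : grid n K) := val x i * #|{: grid n K}| + enum_rank x.
have ltG (x : grid n K) : enum_rank x < #|{: grid n K}| by apply: ltn_ord.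
have rkle i x y : rk i y <= rk i x -> val y i <= val x i.
  rewrite /rk => le; rewrite leqNgt; apply/negP => lt.
  have := leq_mul lt (leqnn #|{: grid n K}|); rewrite mulSn.
  by move: le (ltG x); move: (_ * _) (_ * _) => u v; lia.
have inj i : injective (rk i).
  move=> x y e; apply: enum_rank_inj; apply: val_inj.
  have : val x i = val y i by apply: val_inj; apply/eqP;
    rewrite eqn_leq /= !rkle ?e.
  by move: e; rewrite /rk => e e'; rewrite e' in e; move/addnI: e.
have [|T [T0 HT]] := scarf x0 c inj; first by rewrite card_ord.
exists T; have [t0 t0T] := set0Pn _ T0.
pose mn i := [arg min_(x < t0 in T) (val x i : nat)].
have mnT i : mn i \in T by rewrite /mn; case: arg_minnP.
have mnle i x : x \in T -> val (mn i) i <= val x i.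
  by rewrite /mn; case: arg_minnP => // m mT Hm xT; apply: Hm.
(* If the sum of [g] were at most [K], a grid point above [g] would contradict the choice of [T]. *)
pose g i := if i \in c @: T then (val (mn i) i).+1 else 0.
have gK : K < \sum_i g i.
  rewrite ltnNge; apply/negP => /(grid_above i0)[y yg].
  have [i ic Hi] := HT y; have := rkle _ _ _ (Hi _ (mnT i)).
  by have := yg i; rewrite /g ic => lt; rewrite leqNgt lt.
have near i x : x \in T -> val x i < g i + n.-1.
  move=> xT; have := eqP (valP x); rewrite (bigD1 i) //= => sumx.
  have : \sum_(k | k != i) g k <= \sum_(k | k != i) (val x k).+1.
    by apply: leq_sum => k _; rewrite /g; case: ifP => // _; rewrite ltnS mnle.
  have -> : \sum_(k | k != i) (val x k).+1 = \sum_(k | k != i) val x k + n.-1.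
    under eq_bigr do rewrite -addn1; rewrite big_split /= sum1_card.
    by rewrite cardC1 card_ord.
  by move: gK; rewrite (bigD1 i) //=; lia.
split=> // [i x ic xT|i x x' xT x'T]; have := near i x xT.
  by rewrite /g (negPf ic); lia.
by rewrite /g; case: ifP => _; have := mnle i x' x'T; lia.
Qed.
Local Open Scope ring_scope.

(** * Lexicographic minima and Farkas' lemma *)

Lemma box_cluster (R : realType) (I : finType) (u : nat -> I -> R) :
    (forall k i, 0 <= u k i <= 1) ->
  exists p : I -> R, forall e, 0 < e -> forall K : nat,
    exists2 k, (K <= k)%N & forall i, `|u k i - p i| < e.
Proof.
move=> u01.
pose v k : 'rV[R]_#|I| := \row_j u k (enum_val j).
have box_compact : compact [set w : 'rV[R]_#|I| | forall j, `[0, 1]%classic (w ord0 j)].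
  by apply: (@rV_compact R #|I| (fun=> `[0, 1]%classic)) => j;
    apply: segment_compact.
have [|p [_ clp]] := box_compact (v @ \oo)%classic.
  by exists 0%N => // k _ j; rewrite /= mxE in_itv /= u01.
exists (fun i => p ord0 (enum_rank i)) => e e0 K.
have [||w [[k Kk <-] /= wp]] :=
  clp [set v k | k in [set k | (K <= k)%N]]%classic (ball p e).
- by exists K => // k /= Kk; exists k.
- exact: nbhsx_ballx.
exists k => // i; have [_ /(_ ord0 (enum_rank i))] := wp.
by rewrite /ball /= mxE enum_rankK distrC.
Qed.

Definition dot (R : realType) (I : finType) (w y : I -> R) : R :=
  \sum_i w i * y i.

(** Continuity of a linear form, with tolerance [e / W]: the displacement costs at most
    [(W - 1) * (e / W)], the slack in the bound another [e / W]. *)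
Lemma dot_near (R : realType) (I : finType) (w p : I -> R) (c : R) :
    (forall e, 0 < e ->
       exists2 y, dot w y <= c + e & forall i, `|y i - p i| < e) ->
  dot w p <= c.
Proof.
move=> H; pose W := 1 + \sum_i `|w i|.
have W0 : 0 < W by rewrite ltr_pwDl // sumr_ge0.
apply/ler_addgt0Pr => e e0; have [|y yc yp] := H (e / W); first by rewrite divr_gt0.
have : dot w p - dot w y <= \sum_i `|w i| * (e / W).
  rewrite -sumrB; apply: ler_sum => i _; apply: le_trans (ler_norm _) _.
  by rewrite -mulrBr normrM ler_wpM2l // distrC ltW.
have : e = (1 + \sum_i `|w i|) * (e / W) by rewrite mulrC divfK // gt_eqF.
rewrite -mulr_suml mulrDl mul1r; lra.
Qed.

Lemma dot_near_eq (R : realType) (I : finType) (w p : I -> R) (c : R) :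
    (forall e, 0 < e ->
       exists2 y, `|dot w y - c| <= e & forall i, `|y i - p i| < e) ->
  dot w p = c.
Proof.
move=> H; apply/eqP; rewrite eq_le; apply/andP; split.
  by apply: dot_near => e /H[y yc yp]; exists y => //; move: yc;
    rewrite ler_norml; lra.
have N y : dot (fun i => - w i) y = - dot w y.
  by rewrite -sumrN; apply: eq_bigr => i _; rewrite mulNr.
rewrite -lerN2 -N; apply: dot_near => e /H[y yc yp]; exists y => //.
by move: yc; rewrite N ler_norml; lra.
Qed.

Fixpoint lexmin (R : realType) (I : finType) (K : (I -> R) -> Prop)
    (ws : seq (I -> R)) : (I -> R) -> Prop :=
  if ws is w :: ws' then
    lexmin (fun y => K y /\ forall y', K y' -> dot w y <= dot w y') ws'
  else K.

Lemma lexmin_sub (R : realType) (I : finType) (ws : seq (I -> R))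
  (K : (I -> R) -> Prop) y : lexmin K ws y -> K y.
Proof. by elim: ws K => [|w ws IH] K //= /IH[]. Qed.

Lemma lexmin_head (R : realType) (I : finType) (ws : seq (I -> R)) (w : I -> R)
    (K : (I -> R) -> Prop) y y' :
  lexmin K (w :: ws) y -> K y' -> dot w y <= dot w y'.
Proof. by move=> /= /lexmin_sub[_]; apply. Qed.

(** On a closed subset of the cube a linear form attains its minimum by compactness, and the
    minimizers again form a closed set. *)
Lemma lexmin_exists (R : realType) (I : finType) (ws : seq (I -> R))
    (K : (I -> R) -> Prop) :
    (exists y, K y) -> (forall y, K y -> forall i, 0 <= y i <= 1) ->
    (forall p, (forall e, 0 < e -> exists2 y, K y & forall i, `|y i - p i| < e) ->
       K p) ->
  exists y, lexmin K ws y.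
Proof.
elim: ws K => [|w ws IH] K //= [y0 Ky0] box cl.
have [p [Kp pmin]] : exists p, K p /\ forall y, K y -> dot w p <= dot w y.
  pose E := [set dot w y | y in K]%classic.
  have E0 : has_inf E.
    split; first by exists (dot w y0), y0.
    exists (- \sum_i `|w i|) => _ [y Ky <-]; rewrite -sumrN.
    apply: ler_sum => i _; have /andP[y0' y1] := box y Ky i.
    rewrite lerNl -mulNr (le_trans (ler_norm _)) // normrM normrN.
    by rewrite ger0_norm // ler_piMr.
  have ex k : exists y, K y /\ dot w y < inf E + k.+1%:R^-1.
    have [|_ [y Ky <-] lt] := @inf_adherent _ E k.+1%:R^-1 _ E0;
      first by rewrite invr_gt0.
    by exists y.
  have [u Hu] := choice ex.
  have [p Hp] := box_cluster (fun k => box _ (Hu k).1).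
  exists p; split; first by apply: cl => e e0; have [k _] := Hp e e0 0;
    exists (u k) => //; apply: (Hu k).1.
  move=> y Ky; apply: (@le_trans _ _ (inf E)); last first.
    by apply: ge_inf; [exact: E0.2|exists y].
  apply: dot_near => e e0; have [k Kk up] := Hp e e0 (Num.truncn e^-1).
  exists (u k) => //; apply: le_trans (ltW (Hu k).2) _; rewrite lerD2l.
  rewrite invf_ple ?posrE // ltW // (lt_le_trans (truncnS_gt _)) //.
  by rewrite ler_nat ltnS.
apply: IH.
- by exists p.
- by move=> y [/box].
move=> q Hq; split.
  by apply: cl => e /Hq[y [Ky _]]; exists y.
move=> y' Ky'; apply: dot_near => e e0; have [y [_ ymin] yq] := Hq e e0.
by exists y => //; rewrite (le_trans (ymin _ Ky')) // lerDl ltW.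
Qed.

(** Optimality of [y1] gives [dot w z <= 0] for the first form, that of [y2] gives the converse.
    Hence both moved points are again minimizers, and the next form can be treated. This takes the
    place of continuity of the optimum. *)
Lemma lexmin_exchange (R : realType) (I : finType) (ws : seq (I -> R))
    (K1 K2 : (I -> R) -> Prop) (y1 y2 z : I -> R) :
    lexmin K1 ws y1 -> lexmin K2 ws y2 ->
    K1 (fun i => y1 i - z i) -> K2 (fun i => y2 i + z i) ->
  forall k, (k < size ws)%N -> dot (nth (fun=> 0) ws k) z = 0.
Proof.
elim: ws K1 K2 => [|w ws IH] K1 K2 //= L1 L2 H1 H2.
have [Ky1 m1] := lexmin_sub L1; have [Ky2 m2] := lexmin_sub L2.
have e1 : dot w (fun i => y1 i - z i) = dot w y1 - dot w z.
  by rewrite -sumrB; apply: eq_bigr => i _; rewrite mulrBr.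
have e2 : dot w (fun i => y2 i + z i) = dot w y2 + dot w z.
  by rewrite -big_split; apply: eq_bigr => i _; rewrite mulrDr.
have z0 : dot w z = 0.
  by apply/eqP; rewrite eq_le; have := m1 _ H1; have := m2 _ H2; rewrite e1 e2; lra.
case=> [|k] //= kws; apply: (IH _ _ L1 L2) => //.
  by split=> // y'; rewrite e1 z0 subr0; apply: m1.
by split=> // y'; rewrite e2 z0 addr0; apply: m2.
Qed.

(** The ratio test of the simplex method. *)
Lemma small_step (R : realType) (I : finType) (p z : I -> R) :
    (forall i, 0 <= p i) -> (forall i, z i < 0 -> 0 < p i) ->
  exists2 t, 0 < t & forall i, 0 <= p i + t * z i.
Proof.
move=> p0 zp; pose t := \big[Num.min/1]_(i | z i < 0) (p i / - z i).
have t0 : 0 < t.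
  rewrite /t; elim/big_ind: _ => //= [x y x0 y0|i zi]; first by rewrite lt_min x0.
  by rewrite divr_gt0 ?zp // oppr_gt0.
exists t => // i; have [zi|zi] := ltP (z i) 0; last first.
  by rewrite addr_ge0 // mulr_ge0 // ltW.
have : t <= p i / - z i by rewrite /t (bigD1 i) //= ge_min lexx.
by rewrite ler_pdivlMr ?oppr_gt0 //; lra.
Qed.

(* Bartl's algebraic proof, by induction on the number of forms. *)
Lemma farkas_ord (R : realType) (I : finType) (m : nat) (f : 'I_m -> I -> R)
    (g : I -> R) :
    (forall x, (forall k, dot (f k) x <= 0) -> dot g x <= 0) ->
  exists2 u : 'I_m -> R, forall k, 0 <= u k & forall i, g i = \sum_k u k * f k i.
Proof.
have dotB (h h' : I -> R) t x :
    dot (fun i => h i - t * h' i) x = dot h x - t * dot h' x.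
  rewrite /dot mulr_sumr -sumrB; apply: eq_bigr => i _; ring.
have dotBr (h : I -> R) t x x' :
    dot h (fun i => x i - t * x' i) = dot h x - t * dot h x'.
  rewrite /dot mulr_sumr -sumrB; apply: eq_bigr => i _; ring.
elim: m f g => [|m IH] f g H.
  exists (fun=> 0) => // i; rewrite big_ord0.
  have gg : dot g g <= 0 by apply: H => -[].
  have : g i * g i <= 0.
    apply: le_trans gg; rewrite /dot (bigD1 i) //= lerDl.
      by apply: sumr_ge0 => k _; rewrite -expr2 sqr_ge0.
  by rewrite -expr2 => h; apply/eqP; rewrite -sqrf_eq0 eq_le h sqr_ge0.
pose f0 := f ord0; pose f' k := f (lift ord0 k).
have [H'|] := pselect (forall x, (forall k, dot (f' k) x <= 0) -> dot g x <= 0).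
  have [u u0 Hu] := IH f' g H'.
  exists (fun k => oapp u 0 (unlift ord0 k)).
    by move=> k; case: unliftP => [j _|_] /=.
  move=> i; rewrite big_ord_recl unlift_none /= mul0r add0r Hu.
  by apply: eq_bigr => k _; rewrite liftK.
move=> /existsNP[x /not_implyP[xf /negP]]; rewrite -ltNge => gx.
have t0 : 0 < dot f0 x.
  rewrite ltNge; apply/negP => h; move: gx; rewrite ltNge => /negP; apply.
  by apply: H => k; case: (unliftP ord0 k) => [j ->|->]; [apply: xf|apply: h].
set t := dot f0 x in t0.
(* Composing a form with the projection along [x] onto the kernel of [f0] subtracts a multiple of
   [f0]; so the hypothesis holds for the remaining forms after projection. *)
have [|u u0 Hu] := IH (fun k i => f' k i - dot (f' k) x / t * f0 i)
                      (fun i => g i - dot g x / t * f0 i).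
  move=> y Hy; pose y' i := y i - dot f0 y / t * x i.
  have E h : dot (fun i => h i - dot h x / t * f0 i) y = dot h y'.
    by rewrite dotB dotBr; ring.
  rewrite E; apply: H => k; case: (unliftP ord0 k) => [j ->|->].
    by rewrite -E; apply: Hy.
  by rewrite dotBr -/f0 -/t divfK ?subrr // gt_eqF.
(* The coefficient of [f0] is nonnegative because [x] makes [g] positive and all other forms
   nonpositive. *)
pose s := dot g x / t - \sum_k u k * (dot (f' k) x / t).
exists (fun k => oapp u s (unlift ord0 k)).
  move=> k; case: unliftP => //= _; rewrite /s subr_ge0.
  apply: le_trans (_ : 0 <= _); last by rewrite divr_ge0 // ltW.
  by apply: sumr_le0 => j _; rewrite mulr_ge0_le0 // mulr_le0_ge0 // invr_ge0 ltW.
move=> i; rewrite big_ord_recl unlift_none /=.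
under eq_bigr do rewrite liftK /=.
have E : \sum_k u k * (f' k i - dot (f' k) x / t * f0 i) =
    \sum_k u k * f' k i - (\sum_k u k * (dot (f' k) x / t)) * f0 i.
  by rewrite mulr_suml -sumrB; apply: eq_bigr => k _; ring.
have := Hu i; rewrite E => /eqP; rewrite subr_eq => /eqP ->.
by rewrite /s /f0 /f'; ring.
Qed.

Lemma farkas (R : realType) (I K : finType) (f : K -> I -> R) (g : I -> R) :
    (forall x, (forall k, dot (f k) x <= 0) -> dot g x <= 0) ->
  exists2 u : K -> R, forall k, 0 <= u k & forall i, g i = \sum_k u k * f k i.
Proof.
move=> H; have [|u u0 Hu] := @farkas_ord R I #|K| (fun k => f (enum_val k)) g.
  by move=> x Hx; apply: H => k; rewrite -[k]enum_rankK.
exists (fun k => u (enum_rank k)) => // i.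
rewrite Hu [RHS](reindex (@enum_val K K)) /=; last first.
  by exists enum_rank => k _; rewrite ?enum_valK ?enum_rankK.
by apply: eq_bigr => k _; rewrite enum_valK.
Qed.

(** * Parts of positive depth *)

Definition deep (R : realType) (n d : nat) (a : 'I_n -> 'rV[R]_d) (b : 'I_n -> R)
    (q : 'rV[R]_d) (S : {set 'I_n}) : Prop :=
  forall v, exists2 i, i \in S & ray_meets a b q v i.

Lemma deep_sub (R : realType) (n d : nat) (a : 'I_n -> 'rV[R]_d) (b : 'I_n -> R)
    (q : 'rV[R]_d) (S S' : {set 'I_n}) :
  S \subset S' -> deep a b q S -> deep a b q S'.
Proof. by move=> /subsetP sS dS v; have [i /sS iS' Hi] := dS v; exists i. Qed.

Lemma deep_RD (R : realType) (n d : nat) (a : 'I_n -> 'rV[R]_d) (b : 'I_n -> R)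
    (q : 'rV[R]_d) (S : {set 'I_n}) : deep a b q S -> RD_ge a b S q 1.
Proof.
move=> dS v _; have [i iS Hi] := dS v; rewrite /ray_count card_gt0.
by apply/set0Pn; exists i; rewrite inE iS; apply/asboolP.
Qed.

Lemma dotpDr (R : realType) (d : nat) (u v w : 'rV[R]_d) :
  dotp u (v + w) = dotp u v + dotp u w.
Proof. by rewrite -big_split; apply: eq_bigr => k _; rewrite mxE mulrDr. Qed.

Lemma dotpZr (R : realType) (d : nat) (u v : 'rV[R]_d) (t : R) :
  dotp u (t *: v) = t * dotp u v.
Proof. by rewrite /dotp mulr_sumr; apply: eq_bigr => k _; rewrite mxE mulrCA. Qed.

Lemma deep_on_hyp (R : realType) (n d : nat) (a : 'I_n -> 'rV[R]_d) (b : 'I_n -> R)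
    (q : 'rV[R]_d) (S : {set 'I_n}) (i : 'I_n) :
  i \in S -> on_hyp a b i q -> deep a b q S.
Proof.
move=> iS qi v; exists i => //; left; exists 0; split=> //.
by rewrite /on_hyp dotpDr dotpZr mul0r addr0.
Qed.

(** The line through [q] meets the hyperplane at the parameter
    [(b i - dotp (a i) q) / dotp (a i) v], so on a missed ray numerator and denominator have
    opposite signs. *)
Lemma not_ray_meets (R : realType) (n d : nat) (a : 'I_n -> 'rV[R]_d)
    (b : 'I_n -> R) (q v : 'rV[R]_d) (i : 'I_n) :
  ~ ray_meets a b q v i -> (b i - dotp (a i) q) * dotp (a i) v < 0.
Proof.
move=> nm; have av0 : dotp (a i) v != 0.
  by apply/eqP => e; apply: nm; right.
rewrite ltNge; apply/negP => h; apply: nm; left.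
exists ((b i - dotp (a i) q) / dotp (a i) v); split.
  rewrite -(pmulr_lge0 _ (_ : 0 < dotp (a i) v ^+ 2)) ?exprn_even_gt0 //.
  by rewrite expr2 mulrA divfK.
by rewrite /on_hyp dotpDr dotpZr divfK // addrC subrK.
Qed.

(* [w i s] is the weight of hyperplane [i] with normal [a i] if [s = false]
   and [- a i] if [s = true]. *)
Definition balanced (R : realType) (n d : nat) (a : 'I_n -> 'rV[R]_d)
    (w : 'I_n -> bool -> R) : Prop :=
  \sum_i \sum_(s : bool) ((-1) ^+ s * w i s) *: a i = 0.

Definition side (R : realType) (n d : nat) (a : 'I_n -> 'rV[R]_d) (b : 'I_n -> R)
    (q : 'rV[R]_d) (i : 'I_n) (s : bool) : Prop :=
  0 <= (-1) ^+ s * (b i - dotp (a i) q).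

(** If the ray along [v] missed all of [S], pairing the balanced combination with [v] would give a
    sum of nonpositive terms, one of them negative, equal to 0. *)
Lemma deep_balanced (R : realType) (n d : nat) (a : 'I_n -> 'rV[R]_d)
    (b : 'I_n -> R) (q : 'rV[R]_d) (S : {set 'I_n}) (w : 'I_n -> bool -> R) :
    (forall i s, 0 <= w i s) ->
    (forall i s, 0 < w i s -> i \in S /\ side a b q i s) ->
    (exists i s, 0 < w i s) -> balanced a w -> deep a b q S.
Proof.
move=> w0 wS [i0 [s0 wi0]] bal v.
apply: contrapT => /forall2NP no.
pose T i (s : bool) := (-1) ^+ s * w i s * dotp (a i) v.
have Tneg i s : 0 < w i s -> T i s < 0.
  move=> wis; have [iS sd] := wS i s wis; have [//|nm] := no i.
  have := not_ray_meets nm; move: sd; rewrite /side /T.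
  set c := b i - _; set e := dotp _ v; case: s wis; rewrite ?expr1 ?expr0 => wis.
    rewrite !mulN1r oppr_ge0 => c0 ce; rewrite mulNr oppr_lt0 mulr_gt0 //.
    by rewrite ltNge; apply/negP => e0; move: ce; rewrite ltNge mulr_le0.
  rewrite !mul1r => c0 ce; rewrite pmulr_rlt0 //.
  by rewrite ltNge; apply/negP => e0; move: ce; rewrite ltNge mulr_ge0.
have Tle i s : T i s <= 0.
  have := w0 i s; rewrite le_eqVlt => /orP[/eqP e|/Tneg/ltW//].
  by rewrite /T -e mulr0 mul0r.
have : \sum_i \sum_(s : bool) T i s < 0.
  rewrite (bigD1 i0) //= (bigD1 s0) //= -addrA ltr_nwDl ?Tneg //.
  rewrite -oppr_ge0 opprD addr_ge0 // oppr_ge0 sumr_le0 // => i _.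
  exact: sumr_le0.
suff -> : \sum_i \sum_(s : bool) T i s = 0 by rewrite ltxx.
transitivity (dotp (\sum_i \sum_(s : bool) ((-1) ^+ s * w i s) *: a i) v);
  last first.
  by rewrite bal /dotp big1 // => k _; rewrite mxE mul0r.
rewrite /dotp; under [RHS]eq_bigr do rewrite summxE mulr_suml.
rewrite [RHS]exchange_big; apply: eq_bigr => i _.
under [RHS]eq_bigr do rewrite summxE mulr_suml.
rewrite [RHS]exchange_big; apply: eq_bigr => s _.
by rewrite /T /dotp mulr_sumr; apply: eq_bigr => k _; rewrite mxE mulrA.
Qed.

(* If a hyperplane [i] carries weight with its two signs in distinct parts
   [j] and [k], then [i] contains [q]: the positive combination of the parts
   [j] and [k] in which [i] cancels replaces [j], and [k] becomes [{i}]. *)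
Lemma merge_parts (R : realType) (n d r : nat) (a : 'I_n -> 'rV[R]_d)
    (b : 'I_n -> R) (q : 'rV[R]_d) (J : {set 'I_r})
    (y : 'I_n -> bool -> 'I_r -> R) :
    (forall i, a i != 0) ->
    (forall i s j, 0 <= y i s j) ->
    (forall i s j, j \in J -> 0 < y i s j -> side a b q i s) ->
    (forall i s j k, j \in J -> k \in J -> 0 < y i s j -> 0 < y i s k -> j = k) ->
    (forall j, j \in J -> exists i s, 0 < y i s j) ->
    (forall j, j \in J -> balanced a (fun i s => y i s j)) ->
  exists2 l : 'I_n -> option 'I_r,
    forall i, l i -> exists s j, j \in J /\ 0 < y i s j
    & forall j, j \in J -> deep a b q [set i | l i == Some j].
Proof.
move=> a0; have [m] := ubnP #|J|; elim: m J y => // m IH J y cJ y0 sd uniq ne bal.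
have [[i [s [j [k [jJ kJ jk yj yk]]]]]|noedge] := pselect (exists i s j k,
    [/\ j \in J, k \in J, j != k, 0 < y i s j & 0 < y i (~~ s) k]).
  have yj0 : y i (~~ s) j = 0.
    apply/eqP; rewrite eq_le y0 andbT leNgt; apply: contra jk => h.
    by rewrite (uniq i (~~ s) j k).
  have yk0 : y i s k = 0.
    apply/eqP; rewrite eq_le y0 andbT leNgt; apply: contra jk => h.
    by rewrite (uniq i s j k).
  (* With these factors the two opposite contributions of [i] both have size [A * B] and cancel, so
     its weight can be set to 0. *)
  pose A := y i s j; pose B := y i (~~ s) k.
  pose y' i' s' l := if i' == i then 0 else
    if l == j then B * y i' s' j + A * y i' s' k else y i' s' l.
  have y'pos i' s' l : 0 < y' i' s' l -> i' != i /\
     if l == j then 0 < y i' s' j \/ 0 < y i' s' k else 0 < y i' s' l.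
    rewrite /y'; case: eqP => [_|_]; first by rewrite ltxx.
    case: eqP => // _ h; split=> //; apply/orP; apply: contraLR h.
    rewrite negb_or -!leNgt => /andP[h1 h2].
    by rewrite -oppr_ge0 opprD addr_ge0 // oppr_ge0 mulr_ge0_le0 // ltW.
  have [||||||] := IH (J :\ k) y'.
  - by rewrite (cardsD1 k) kJ in cJ.
  - move=> i' s' l; rewrite /y'; case: ifP => // _; case: ifP => // _.
    by rewrite addr_ge0 // mulr_ge0 // ltW.
  - move=> i' s' l; rewrite !inE => /andP[_ lJ] /y'pos[_].
    case: eqP => [_ [] h|_ h].
    + exact: sd jJ h.
    + exact: sd kJ h.
    + exact: sd lJ h.
  - move=> i' s' l l'; rewrite !inE => /andP[lk lJ] /andP[l'k l'J] /y'pos[_ h] /y'pos[_ h'].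
    move: h h'.
    have [lj|lj] := eqVneq l j; have [l'j|l'j] := eqVneq l' j => h h'.
    + by rewrite lj l'j.
    + case: h => h; first by rewrite lj (uniq _ _ _ _ jJ l'J h h').
      by rewrite (uniq _ _ _ _ l'J kJ h' h) eqxx in l'k.
    + case: h' => h'; first by rewrite l'j (uniq _ _ _ _ lJ jJ h h').
      by rewrite (uniq _ _ _ _ lJ kJ h h') eqxx in lk.
    + exact: uniq h h'.
  - move=> l; rewrite !inE => /andP[lk lJ]; have [->|lj] := eqVneq l j.
      (* If the merged part were empty, part [j] would use [i] alone, and its balance would make a
         nonzero multiple of [a i] vanish. *)
      have [//|no] := pselect (exists i' s', 0 < y' i' s' j).
      have y0' i' s' : i' != i -> y i' s' j = 0.
        move=> i'i; apply/eqP; rewrite eq_le y0 andbT leNgt; apply/negP => h.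
        apply: no; exists i', s'; rewrite /y' (negPf i'i) eqxx.
        by rewrite ltr_pwDl ?mulr_gt0 // mulr_ge0 // ltW.
      have := bal j jJ; rewrite /balanced (bigD1 i) //= [X in _ + X]big1 ?addr0; last first.
        by move=> i' i'i; apply: big1 => s' _; rewrite y0' // mulr0 scale0r.
      rewrite (bigD1 s) //= [X in _ + X]big1 ?addr0 => [|s' ss']; last first.
        suff -> : s' = ~~ s by rewrite yj0 mulr0 scale0r.
        by move: ss'; case: (s'); case: (s).
      move=> /eqP; by rewrite scaler_eq0 (negPf (a0 i)) orbF mulf_eq0 signr_eq0 (gt_eqF yj).
    have [i' [s' h]] := ne l lJ; exists i', s'; rewrite /y' (negPf lj).
    case: eqP => [e|//]; move: h; rewrite e => h.
    have [es|es] := eqVneq s' s;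
      first by rewrite (uniq i s l j) ?eqxx // -?es in lj.
    have es' : s' = ~~ s by move: es; case: (s'); case: (s).
    by rewrite (uniq i (~~ s) l k) ?eqxx // -?es' in lk.
  - move=> l; rewrite !inE => /andP[lk lJ].
    have [->|lj] := eqVneq l j.
      transitivity (B *: (\sum_i' \sum_(s' : bool) ((-1) ^+ s' * y i' s' j) *: a i')
                  + A *: (\sum_i' \sum_(s' : bool) ((-1) ^+ s' * y i' s' k) *: a i')).
        rewrite !scaler_sumr -big_split; apply: eq_bigr => i' _ /=.
        rewrite !scaler_sumr -big_split /= /y' eqxx.
        have [->|_] := eqVneq i' i; last first.
          by apply: eq_bigr => s' _; rewrite !scalerA -scalerDl;
            congr (_ *: _); ring.
        rewrite !big_bool /= !scalerA -!scalerDl; congr (_ *: _).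
        by move: yj0 yk0; rewrite /A /B; case: (s) => /= -> ->; ring.
      by rewrite (bal j jJ) (bal k kJ) !scaler0 addr0.
    transitivity (\sum_i' \sum_(s' : bool) ((-1) ^+ s' * y i' s' l) *: a i').
      apply: eq_bigr => i' _; apply: eq_bigr => s' _; rewrite /y' (negPf lj).
      have [->|//] := eqVneq i' i; congr (_ * _ *: _); apply/esym/eqP.
      rewrite eq_le y0 andbT leNgt; apply/negP => h.
      have [es|es] := eqVneq s' s;
        first by rewrite (uniq i s l j) ?eqxx // -?es in lj.
      have es' : s' = ~~ s by move: es; case: (s'); case: (s).
      by rewrite (uniq i (~~ s) l k) ?eqxx // -?es' in lk.
    exact: bal.
  move=> l' l'act l'deep.
  have qi : on_hyp a b i q.
    have := sd _ _ _ jJ yj; have := sd _ _ _ kJ yk; rewrite /side /on_hyp.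
    case: (s) => /=; rewrite !expr1 !expr0 !mul1r mulN1r oppr_ge0 => h h'.
      by apply/eqP; rewrite eq_sym -subr_eq0 eq_le h h'.
    by apply/eqP; rewrite eq_sym -subr_eq0 eq_le h h'.
  have l'i : l' i = None.
    case e : (l' i) => [u|//]; have [|s' [v [_]]] := l'act i; first by rewrite e.
    by rewrite /y' eqxx ltxx.
  exists (fun i' => if i' == i then Some k else l' i').
    move=> i'; case: eqP => [->|_] => [_|/l'act[s' [l [lJ h]]]].
      by exists s, j.
    move: lJ h; rewrite !inE => /andP[lk lJ] /y'pos[_].
    case: eqP => [_ [] h|_ h]; first by exists s', j.
      by exists s', k.
    by exists s', l.
  move=> l lJ; have [->|lk] := eqVneq l k.
    by apply: (deep_on_hyp (i := i)); rewrite // inE eqxx.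
  apply: deep_sub (l'deep l _); last by rewrite !inE lk.
  apply/subsetP => i'; rewrite !inE; have [->|//] := eqVneq i' i.
  by rewrite l'i.
(* No hyperplane is shared by two parts any more, so the choice made by [pick] is forced. *)
pose l i := [pick j in J | [exists s, 0 < y i s j]].
exists l.
  move=> i; rewrite /l; case: pickP => // j /andP[jJ /existsP[s h]] _.
  by exists s, j.
move=> j jJ; apply: (deep_balanced (w := fun i s => y i s j)) => //.
- move=> i s h; split; last exact: sd h.
  rewrite inE /l; case: pickP => [k /andP[kJ /existsP[s' h']]|/(_ j)]; last first.
    by rewrite jJ; move/negbT/existsP; case; exists s.
  apply/eqP; congr Some; have [e|e] := eqVneq s' s.
    by apply: (uniq i s); rewrite -?e // e.
  apply/eqP; apply: contrapT => /negP kj; apply: noedge; exists i, s, j, k;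
    split=> //.
    by rewrite eq_sym.
  by move: e h'; case: (s'); case: (s).
- exact: ne.
- exact: bal.
Qed.

Lemma dot_comb (R : realType) (I : finType) (w y z : I -> R) (t : R) :
  dot w (fun x => y x + t * z x) = dot w y + t * dot w z.
Proof. by rewrite /dot mulr_sumr -big_split; apply: eq_bigr => x _ /=; ring. Qed.

(** * The linear program *)

(* A variable [(i, s, j)] is the weight with which part [j] uses hyperplane [i]
   with sign [s]. The constraints fix the total weight [mu i] of each
   hyperplane and [1 / r] of each part, and balance the normals in each part. *)
Definition constr (R : realType) (n d r : nat) (a : 'I_n -> 'rV[R]_d)
    (c : 'I_n + 'I_r * option 'I_d) (x : 'I_n * bool * 'I_r) : R :=
  match c with
  | inl i => (x.1.1 == i)%:R
  | inr (j, o) => (x.2 == j)%:R *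
      (if o is Some k then (-1) ^+ x.1.2 * a x.1.1 0 k else 1)
  end.

Definition constr_rhs (R : realType) (n d r : nat) (mu : 'I_n -> R)
    (c : 'I_n + 'I_r * option 'I_d) : R :=
  match c with
  | inl i => mu i
  | inr (_, None) => r%:R^-1
  | inr (_, Some _) => 0
  end.

Definition feasible (R : realType) (n d r : nat) (a : 'I_n -> 'rV[R]_d)
    (mu : 'I_n -> R) (y : 'I_n * bool * 'I_r -> R) : Prop :=
  (forall x, 0 <= y x) /\ forall c, dot (constr a c) y = constr_rhs mu c.

Definition cost (R : realType) (n r : nat) (b : 'I_n -> R)
    (x : 'I_n * bool * 'I_r) : R := - ((-1) ^+ x.1.2 * b x.1.1).

(** The coordinate forms after the cost break all ties. *)
Definition optimal (R : realType) (n d r : nat) (a : 'I_n -> 'rV[R]_d)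
    (b mu : 'I_n -> R) : ('I_n * bool * 'I_r -> R) -> Prop :=
  lexmin (feasible a mu)
    (cost b :: [seq (fun x' => (x' == x)%:R) | x <- enum {: 'I_n * bool * 'I_r}]).

Lemma sum_triple (R : realType) (n r : nat) (F : 'I_n * bool * 'I_r -> R) :
  \sum_x F x = \sum_i \sum_s \sum_j F (i, s, j).
Proof.
rewrite pair_bigA pair_bigA; apply: eq_bigr => x _ /=.
by rewrite -!surjective_pairing.
Qed.

Lemma dot_color (R : realType) (n d r : nat) (a : 'I_n -> 'rV[R]_d)
    (y : 'I_n * bool * 'I_r -> R) (i : 'I_n) :
  dot (constr a (inl i)) y = \sum_s \sum_j y (i, s, j).
Proof.
rewrite /dot sum_triple (bigD1 i) //= [X in _ + X]big1 ?addr0 => [|k /negPf ki].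
  by apply: eq_bigr => s _; apply: eq_bigr => j _; rewrite eqxx mul1r.
by rewrite big1 // => s _; rewrite big1 // => j _; rewrite ki mul0r.
Qed.

Lemma dot_part (R : realType) (n d r : nat) (a : 'I_n -> 'rV[R]_d)
    (y : 'I_n * bool * 'I_r -> R) (j : 'I_r) (o : option 'I_d) :
  dot (constr a (inr (j, o))) y =
  \sum_i \sum_(s : bool)
    (if o is Some k then (-1) ^+ s * a i 0 k else 1) * y (i, s, j).
Proof.
rewrite /dot sum_triple; apply: eq_bigr => i _; apply: eq_bigr => s _.
rewrite (bigD1 j) //= [X in _ + X]big1 ?addr0 => [|k /negPf kj].
  by rewrite eqxx mul1r.
by rewrite kj !mul0r.
Qed.

Lemma feasible_move (R : realType) (n d r : nat) (a : 'I_n -> 'rV[R]_d)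
    (mu : 'I_n -> R) (y z : 'I_n * bool * 'I_r -> R) (t : R) :
    feasible a mu y -> (forall c, dot (constr a c) z = 0) ->
    (forall x, 0 <= y x + t * z x) ->
  feasible a mu (fun x => y x + t * z x).
Proof. by move=> [_ yc] z0 yz; split=> // c; rewrite dot_comb z0 mulr0 addr0. Qed.

Lemma feasible_diff (R : realType) (n d r : nat) (a : 'I_n -> 'rV[R]_d)
    (mu : 'I_n -> R) (y y' : 'I_n * bool * 'I_r -> R) :
    feasible a mu y -> feasible a mu y' ->
  forall c, dot (constr a c) (fun x => y x - y' x) = 0.
Proof.
move=> [_ yc] [_ y'c] c.
have -> : dot (constr a c) (fun x => y x - y' x) =
   dot (constr a c) (fun x => y x + (-1) * y' x).
  by apply: eq_bigr => x _; rewrite mulN1r.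
by rewrite dot_comb yc y'c mulN1r subrr.
Qed.

Lemma feasible_exists (R : realType) (n d r : nat) (a : 'I_n -> 'rV[R]_d)
    (mu : 'I_n -> R) : (0 < r)%N -> (forall i, 0 <= mu i) -> \sum_i mu i = 1 ->
  feasible (r := r) a mu (fun x => mu x.1.1 / (2 * r%:R)).
Proof.
move=> r0 mu0 mu1; have rn0 : r%:R != 0 :> R by rewrite pnatr_eq0 -lt0n.
split=> [x|[i|[j [k|]]]]; first by rewrite divr_ge0 // mulr_ge0.
- rewrite dot_color /= big_bool /= !sumr_const card_ord -mulr_natr; field.
  by rewrite rn0.
- rewrite dot_part big1 // => i _; rewrite big_bool /= expr1 expr0; ring.
- rewrite dot_part /=; under eq_bigr do rewrite big_bool /= !mul1r.
  rewrite big_split /= -!mulr_suml mu1; field; by rewrite rn0.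
Qed.

Lemma feasible_le (R : realType) (n d r : nat) (a : 'I_n -> 'rV[R]_d)
    (mu : 'I_n -> R) (y : 'I_n * bool * 'I_r -> R) i s j :
  feasible a mu y -> y (i, s, j) <= mu i.
Proof.
move=> [y0 /(_ (inl i)) /=]; rewrite dot_color => <-.
rewrite (bigD1 s) //= (bigD1 j) //= -addrA lerDl addr_ge0 ?sumr_ge0 // => s' _.
exact: sumr_ge0.
Qed.

Lemma optimal_exists (R : realType) (n d r : nat) (a : 'I_n -> 'rV[R]_d)
    (b mu : 'I_n -> R) : (0 < r)%N -> (forall i, 0 <= mu i <= 1) ->
    \sum_i mu i = 1 ->
  exists y : 'I_n * bool * 'I_r -> R, optimal a b mu y.
Proof.
move=> r0 mu01 mu1; apply: lexmin_exists.
- exists (fun x => mu x.1.1 / (2 * r%:R)); apply: feasible_exists => // i.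
  by have /andP[] := mu01 i.
- move=> y fy [[i s] j]; rewrite (proj1 fy) /=.
  by apply: le_trans (feasible_le _ _ _ fy) _; have /andP[] := mu01 i.
- move=> p Hp; split=> [x|c].
    apply/ler_addgt0Pr => e e0; have [y [y0 _] yp] := Hp e e0.
    by have := yp x; have := y0 x; rewrite ltr_norml; lra.
  apply: dot_near_eq => e e0; have [y [_ yc] yp] := Hp e e0.
  by exists y => //; rewrite yc subrr normr0 ltW.
Qed.

Lemma optimal_exchange (R : realType) (n d r : nat) (a : 'I_n -> 'rV[R]_d)
    (b mu1 mu2 : 'I_n -> R) (y1 y2 z : 'I_n * bool * 'I_r -> R) :
    optimal a b mu1 y1 -> optimal a b mu2 y2 ->
    feasible a mu1 (fun x => y1 x - z x) -> feasible a mu2 (fun x => y2 x + z x) ->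
  forall x, z x = 0.
Proof.
move=> o1 o2 f1 f2 x; have := lexmin_exchange o1 o2 f1 f2.
move=> /(_ (index x (enum {: 'I_n * bool * 'I_r})).+1) /=.
have xin : x \in enum {: 'I_n * bool * 'I_r} by rewrite mem_enum.
rewrite size_map ltnS index_mem xin => /(_ isT).
rewrite (nth_map x) ?index_mem // nth_index // => <-.
rewrite /dot (bigD1 x) //= eqxx mul1r big1 ?addr0 // => x' /negPf ->.
by rewrite mul0r.
Qed.

Lemma left_kernel (R : realType) (n : nat) (K : finType) (E : K -> 'I_n -> R) :
  (#|K| < n)%N ->
  exists2 t : 'I_n -> R, exists i, t i != 0 & forall c, \sum_i t i * E c i = 0.
Proof.
move=> Kn; pose M : 'M[R]_(n, #|K|) := \matrix_(i, c) E (enum_val c) i.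
have : kermx M != 0.
  by rewrite kermx_eq0 /row_free ltn_eqF // (leq_ltn_trans (rank_leq_col _)).
case/rowV0Pn => v /sub_kermxP vM; case/rV0Pn => i vi.
exists (fun i => v 0 i) => [|c]; first by exists i.
have /rowP/(_ (enum_rank c)) := vM; rewrite !mxE => vMc.
by rewrite -[RHS]vMc; apply: eq_bigr => k _; rewrite mxE enum_rankK.
Qed.

(* If every hyperplane were used by two parts with the same sign, the weights
   could be moved in both directions, since [n > (r - 1) (d + 1)]. *)
Lemma optimal_unsplit (R : realType) (n d r : nat) (a : 'I_n -> 'rV[R]_d)
    (b mu : 'I_n -> R) (y : 'I_n * bool * 'I_r -> R) :
    ((r - 1) * (d + 1) < n)%N -> optimal a b mu y ->
  exists i, forall s j k, 0 < y (i, s, j) -> 0 < y (i, s, k) -> j = k.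
Proof.
case: r y => [|r] y rn oy.
  by exists (Ordinal rn) => s [].
apply: contrapT => /forallNP no.
have ex i : exists p : bool * 'I_r.+1 * 'I_r.+1,
   [/\ 0 < y (i, p.1.1, p.1.2), 0 < y (i, p.1.1, p.2) & p.1.2 != p.2].
  apply: contrapT => /forallNP nop; apply: (no i) => s j k yj yk.
  by apply/eqP; apply: contrapT => /negP jk; apply: (nop (s, j, k)).
have {ex no}[p Hp] := choice ex.
pose s i := (p i).1.1; pose j i := (p i).1.2; pose k i := (p i).2.
pose E c i : R := constr a c (i, s i, j i) - constr a c (i, s i, k i).
(* Only the constraints of the parts other than the first are imposed; those of the first follow,
   since by [sumE] the contributions to all parts add up to 0. *)
have [|t [i0 ti0] tE] :=
   @left_kernel R n _ (fun c : 'I_r * option 'I_d => E (inr (lift ord0 c.1, c.2))).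
  by rewrite card_prod card_option !card_ord; move: rn; rewrite subn1 addn1.
(* Moves the amount [t i] of hyperplane [i] from part [k i] to part [j i], keeping its sign and its
   total. *)
pose z (x : 'I_n * bool * 'I_r.+1) : R := t x.1.1 * (x.1.2 == s x.1.1)%:R *
  ((x.2 == j x.1.1)%:R - (x.2 == k x.1.1)%:R).
have zE c : dot (constr a c) z = \sum_i t i * E c i.
  rewrite /dot sum_triple; apply: eq_bigr => i _.
  rewrite (bigD1 (s i)) //= [X in _ + X]big1 ?addr0 => [|s' /negPf ss']; last first.
    by apply: big1 => j' _; rewrite /z /= ss' mulr0 mul0r mulr0.
  under eq_bigr do rewrite /z /= eqxx mulr1 mulrA mulrBr.
  rewrite sumrB (bigD1 (j i)) //= [X in _ + X - _]big1 ?addr0; last first.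
    by move=> j' /negPf ->; rewrite mulr0.
  rewrite (bigD1 (k i)) //= [X in _ - (_ + X)]big1 ?addr0; last first.
    by move=> j' /negPf ->; rewrite mulr0.
  by rewrite !eqxx !mulr1 -mulrBl mulrC.
have sumE o i : \sum_l E (inr (l, o)) i = 0.
  have one (l0 : 'I_r.+1) : \sum_l (l0 == l)%:R = 1 :> R.
    rewrite (bigD1 l0) //= eqxx big1 ?addr0 // => l /negPf.
    by rewrite eq_sym => ->.
  by rewrite sumrB -!mulr_suml !one subrr.
have z0 c : dot (constr a c) z = 0.
  rewrite zE; case: c => [i|[l o]].
    by apply: big1 => i' _; rewrite /E /= subrr mulr0.
  case: (unliftP ord0 l) => [l' ->|->]; first exact: tE (l', o).
  transitivity (- \sum_(l' < r) \sum_i t i * E (inr (lift ord0 l', o)) i).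
    rewrite exchange_big -sumrN; apply: eq_bigr => i _ /=.
    rewrite -mulr_sumr -mulrN; congr (_ * _); apply/eqP.
    by have := sumE o i; rewrite big_ord_recl -addr_eq0 => ->.
  by rewrite big1 ?oppr0 // => l' _; apply: tE (l', o).
have znz x : z x != 0 -> 0 < y x.
  case: x => [[i s'] l]; rewrite /z /=; have [->|_] := eqVneq s' (s i); last first.
    by rewrite mulr0 mul0r eqxx.
  have [yj yk _] := Hp i; have [->//|_] := eqVneq l (j i).
  by have [->//|_] := eqVneq l (k i); rewrite subrr mulr0 eqxx.
have y0 := proj1 (lexmin_sub oy).
have [t1 t10 h1] := small_step y0 (fun x (zx : z x < 0) => znz x (ltr0_neq0 zx)).
have [|t2 t20 h2] := @small_step _ _ y (fun x => - z x) y0.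
  by move=> x; rewrite oppr_lt0 => /lt0r_neq0/znz.
pose t' := Num.min t1 t2.
have t'0 : 0 < t' by rewrite lt_min t10.
have h u x : (u == 1) || (u == -1) -> 0 <= y x + t' * u * z x.
  have t1' : t' <= t1 by rewrite ge_min lexx.
  have t2' : t' <= t2 by rewrite ge_min lexx orbT.
  have := h1 x; have := h2 x; have := y0 x.
  move=> a0 a2 a1 /orP[/eqP ->|/eqP ->].
    have [zx|zx] := leP 0 (z x); nra.
  have [zx|zx] := leP 0 (z x); nra.
have H := @optimal_exchange _ _ _ _ a b mu mu y y (fun x => t' * z x) oy oy.
have : t' * z (i0, s i0, j i0) = 0.
  apply: H.
    have := feasible_move (t := t' * (-1)) (lexmin_sub oy) z0.
    have -> : (fun x => y x + t' * -1 * z x) = (fun x => y x - t' * z x).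
      by apply/funext => x; ring.
    by apply=> x; have := h (-1) x; rewrite eqxx orbT => /(_ isT); lra.
  apply: (feasible_move (lexmin_sub oy) z0) => x.
  by have := h 1 x; rewrite eqxx mulr1; apply.
move/eqP; rewrite mulf_eq0 (gt_eqF t'0) /= /z /= !eqxx.
have [_ _ /negPf ->] := Hp i0.
by rewrite subr0 !mulr1 (negPf ti0).
Qed.

Lemma half_separation (R : realType) (I : finType) (z : I -> R) :
  exists2 e, 0 < e & forall x, z x != 0 -> e <= `|z x| / 2.
Proof.
pose e := \big[Num.min/1]_(x | z x != 0) (`|z x| / 2).
exists e => [|x zx]; last by rewrite /e (bigD1 x) //= ge_min lexx.
rewrite /e; elim/big_ind: _ => //= [u v u0 v0|x zx]; first by rewrite lt_min u0.
by rewrite divr_gt0 // normr_gt0.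
Qed.

(** Being within half the gap of [p], the value [y] can give up half the gap and stay above [p']. *)
Lemma near_half_sub (R : realType) (y p p' e : R) :
  (p - p' != 0 -> e <= `|p - p'| / 2) -> 0 <= y -> 0 <= p' -> `|y - p| < e ->
  0 <= y - 2^-1 * (p - p').
Proof.
move=> H y0 p'0; rewrite ltr_norml => /andP[h1 h2].
have [pp|pp] := leP (p - p') 0; first by lra.
by have := H (lt0r_neq0 pp); rewrite gtr0_norm //; lra.
Qed.

Lemma near_half_add (R : realType) (y p p' e : R) :
  (p' - p != 0 -> e <= `|p' - p| / 2) -> 0 <= y -> 0 <= p' -> `|y - p| < e ->
  0 <= y + 2^-1 * (p' - p).
Proof.
move=> H y0 p'0 h; have := near_half_sub (e := e) (p' := p') _ y0 p'0 h.
rewrite -opprB oppr_eq0 normrN => /(_ H); lra.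
Qed.

(** Linear programming duality. The Farkas multipliers of the normals form [q]; those of the sign
    conditions are the residuals [b i - dotp (a i) q], with a sign that agrees with every sign in
    use. *)
Lemma optimal_dual (R : realType) (n d r : nat) (a : 'I_n -> 'rV[R]_d)
    (b mu : 'I_n -> R) (y : 'I_n * bool * 'I_r -> R) :
    (0 < r)%N -> feasible a mu y ->
    (forall y' : 'I_n * bool * 'I_r -> R,
      feasible a mu y' -> dot (cost b) y <= dot (cost b) y') ->
  exists q : 'rV[R]_d, forall i s j, 0 < y (i, s, j) -> side a b q i s.
Proof.
move=> r0 [y0 yc] ymin; have rn0 : 0 < r%:R :> R by rewrite ltr0n.
have sumc (c : R) : \sum_(j < r) c = r%:R * c.
  by rewrite sumr_const card_ord mulr_natl.
pose mass i s := \sum_j y (i, s, j).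
have mass0 i s : 0 <= mass i s by apply: sumr_ge0.
(* Averaging over the parts preserves feasibility and cost, and makes one [q] serve all parts. *)
pose ys (x : 'I_n * bool * 'I_r) := mass x.1.1 x.1.2 / r%:R.
have ysf : feasible a mu ys.
  split=> [x|[i|[j o]]]; first by rewrite divr_ge0 // ltW.
    rewrite -yc !dot_color; apply: eq_bigr => s _.
    by rewrite /ys /= sumc mulrC divfK // gt_eqF.
  transitivity (\sum_j' dot (constr a (inr (j', o))) y / r%:R).
    rewrite dot_part -[RHS]mulr_suml; under [in RHS]eq_bigr do rewrite dot_part.
    rewrite [in RHS]exchange_big /= mulr_suml; apply: eq_bigr => i _.
    rewrite [in RHS]exchange_big /= mulr_suml; apply: eq_bigr => s _.
    by rewrite /ys /mass -mulr_sumr mulrA.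
  under eq_bigr do rewrite yc /=.
  by rewrite -mulr_suml sumc [r%:R * _]mulrC mulfK // gt_eqF.
pose f (c : 'I_d * bool + 'I_n * bool) (i : 'I_n) : R := match c with
  | inl (k, s) => (-1) ^+ s * a i 0 k
  | inr (i0, s) => if mass i0 (~~ s) == 0 then (-1) ^+ s * (i == i0)%:R else 0
  end.
have dotX (x : 'I_n -> R) i0 (t : R) : dot (fun i => t * (i == i0)%:R) x = t * x i0.
  rewrite /dot (bigD1 i0) //= eqxx mulr1 big1 ?addr0 // => i /negPf ->.
  by rewrite mulr0 mul0r.
have [x Hx|u u0 bu] := @farkas _ _ _ f b.
  have xa k : \sum_i a i 0 k * x i = 0.
    have h1 := Hx (inl (k, true)); have h2 := Hx (inl (k, false)).
    apply/eqP; rewrite eq_le; apply/andP; split.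
      by apply: le_trans h2; rewrite /dot ler_sum // => i _; rewrite /= mul1r.
    rewrite -oppr_le0; apply: le_trans h1; rewrite /dot -sumrN ler_sum // => i _.
    by rewrite /= expr1 mulN1r mulNr.
  have xm i (s : bool) : (-1) ^+ s * x i < 0 -> 0 < mass i s.
    move=> h; rewrite lt0r mass0 andbT; apply/negP => m0.
    have := Hx (inr (i, ~~ s)); rewrite /dot /f negbK m0.
    rewrite -/(dot _ x) dotX leNgt => /negP; apply.
    by move: h; case: (s); rewrite /= !(expr1, expr0); lra.
  pose z (v : 'I_n * bool * 'I_r) := (-1) ^+ v.1.2 * x v.1.1.
  have zc c : dot (constr a c) z = 0.
    case: c => [i|[j o]]; first by rewrite dot_color big_bool /z /= !sumr_const -mulrnDl expr1 mulN1r mul1r addNr mul0rn.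
    rewrite dot_part; under eq_bigr do rewrite big_bool /z /= !(expr1, expr0).
    case: o => [k|].
      transitivity (\sum_i 2 * (a i 0 k * x i));
        first by apply: eq_bigr => i _; ring.
      by rewrite -mulr_sumr xa mulr0.
    by apply: big1 => i _; ring.
  have [|t t0 ht] := @small_step _ _ ys z (proj1 ysf).
    by move=> [[i s] j] /xm h; rewrite divr_gt0.
  have := ymin _ (feasible_move ysf zc ht); rewrite dot_comb.
  have -> : dot (cost b) ys = dot (cost b) y.
    rewrite /dot !sum_triple; apply: eq_bigr => i _; apply: eq_bigr => s _.
    rewrite /cost /ys /= -[RHS]mulr_sumr -/(mass i s) sumc.
    by rewrite mulrCA mulrC [r%:R * _]mulrC divfK ?gt_eqF // mulrC.
  have -> : dot (cost b) z = - (2 * r%:R * dot b x).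
    rewrite /dot sum_triple mulr_sumr -sumrN; apply: eq_bigr => i _.
    by rewrite big_bool /cost /z /= !sumc expr1 expr0; ring.
  rewrite lerDl pmulr_rge0 // oppr_ge0 pmulr_rle0 // mulr_gt0 //.
exists (\row_k (u (inl (k, false)) - u (inl (k, true)))) => i s j yij.
have ms : mass i s != 0.
  rewrite gt_eqF // /mass (bigD1 j) //= ltr_pwDl // sumr_ge0 //.
have E : b i - dotp (a i) (\row_k (u (inl (k, false)) - u (inl (k, true)))) =
    \sum_(s : bool) u (inr (i, s)) * f (inr (i, s)) i.
  have sum2 (T : finType) (F : T * bool -> R) :
      \sum_p F p = \sum_x (F (x, true) + F (x, false)).
    have -> : \sum_p F p = \sum_x \sum_s F (x, s).
      by rewrite pair_bigA; apply: eq_bigr => -[].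
    by apply: eq_bigr => x _; rewrite big_bool.
  rewrite bu big_sumType !sum2 /= big_bool.
  rewrite addrC -addrA [X in _ + X](_ : _ = 0) ?addr0.
    rewrite (bigD1 i) //= big1 ?addr0 // => k /negPf ki.
    by rewrite [i == k]eq_sym ki !mulr0 !if_same !mulr0 addr0.
  rewrite /dotp -sumrB big1 // => k _; rewrite mxE !(expr1, expr0); ring.
rewrite /side E big_bool /f /= !(expr1, expr0) eqxx; move: ms.
have := u0 (inr (i, true)); have := u0 (inr (i, false)).
case: (s) => /= h h' /negPf -> /=; case: ifP => _; rewrite !(expr1, expr0); lra.
Qed.

(** * Approximate solutions on grids and their limit *)

Lemma approximate_optima (R : realType) (n d r : nat) (a : 'I_n -> 'rV[R]_d)
    (b : 'I_n -> R) (K : nat) :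
    (0 < r)%N -> (1 < n)%N -> ((r - 1) * (d + 1) < n)%N ->
  exists My : 'I_n -> ('I_n -> R) * ('I_n * bool * 'I_r -> R),
    [/\ forall i k, 0 <= (My i).1 k <= 1,
        forall i, optimal a b (My i).1 (My i).2,
        forall i i' k, (My i).1 k <= (My i').1 k + n%:R / K.+1%:R
      & forall i, (My i).1 i <= n%:R / K.+1%:R \/
          forall s j k, 0 < (My i).2 (i, s, j) -> 0 < (My i).2 (i, s, k) -> j = k].
Proof.
move=> r0 n1 rn; have K0 : 0 < K.+1%:R :> R by rewrite ltr0n.
pose mu (x : grid n K.+1) (i : 'I_n) : R := (val x i)%:R / K.+1%:R.
have mu01 x i : 0 <= mu x i <= 1.
  rewrite /mu divr_ge0 //= ler_pdivrMr // mul1r ler_nat.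
  by have := ltn_ord (val x i); rewrite ltnS.
have mu1 x : \sum_i mu x i = 1.
  by rewrite -mulr_suml -natr_sum (eqP (valP x)) divff // gt_eqF.
have [Y HY] := choice (fun x => optimal_exists a b r0 (mu01 x) (mu1 x)).
(* Each grid point is coloured by a hyperplane that no two parts use with the same sign. *)
have [c Hc] := choice (fun x => optimal_unsplit rn (HY x)).
have [T [T0 Tout Tnear]] := scarf_grid c n1.
have [x0 x0T] := set0Pn _ T0.
(* If colour [i] does not occur, the default [x0] serves: every point of [T] then has a small
   coordinate [i]. *)
pose pt i := odflt x0 [pick x in T | c x == i].
have ptT i : pt i \in T by rewrite /pt; case: pickP => //= x /andP[].
exists (fun i => (mu (pt i), Y (pt i))); split=> //= [i i' k|i].
  rewrite -mulrDl ler_pM2r ?invr_gt0 // -natrD ler_nat ltnW //.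
  by apply: Tnear.
have [/imsetP[x xT ci]|ic] := boolP (i \in c @: T).
  right; suff e : c (pt i) = i by have := Hc (pt i); rewrite e.
  rewrite /pt; case: pickP => [x' /andP[_ /eqP]//|/(_ x)].
  by rewrite xT ci eqxx.
left; rewrite ler_pM2r ?invr_gt0 // ler_nat ltnW //.
exact: Tout ic (ptT i).
Qed.

Lemma unsplit_optimum (R : realType) (n d r : nat) (a : 'I_n -> 'rV[R]_d)
    (b : 'I_n -> R) :
    (0 < r)%N -> (1 < n)%N -> ((r - 1) * (d + 1) < n)%N ->
  exists (mu : 'I_n -> R) (y : 'I_n * bool * 'I_r -> R),
    [/\ feasible a mu y,
        forall y' : 'I_n * bool * 'I_r -> R,
          feasible a mu y' -> dot (cost b) y <= dot (cost b) y'
      & forall i s j k, 0 < y (i, s, j) -> 0 < y (i, s, k) -> j = k].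
Proof.
move=> r0 n1 rn.
have [My HMy] := choice (fun K => @approximate_optima R n d r a b K r0 n1 rn).
(* All weights and optima of stage [K] are packed into one point of a cube, so that they converge
   along common indices. *)
pose u K (v : 'I_n * ('I_n + 'I_n * bool * 'I_r)) : R := match v.2 with
  | inl k => (My K v.1).1 k | inr x => (My K v.1).2 x end.
have [K [i [k|[[k s] j]]]|p Hp] := @box_cluster R _ u.
- by have [/(_ i k)] := HMy K.
- have [/(_ i k)/andP[_ M1] /(_ i) o _ _] := HMy K.
  have f := lexmin_sub o; rewrite /u /= (proj1 f) /=.
  exact: le_trans (feasible_le _ _ _ f) M1.
pose M i k := p (i, inl k); pose Z i x := p (i, inr x).
have Hp' e : 0 < e -> exists K, n%:R / K.+1%:R < e /\ forall v, `|u K v - p v| < e.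
  move=> e0; have [K Kk up] := Hp e e0 (Num.truncn (n%:R / e)).
  exists K; split=> //; rewrite ltr_pdivrMr ?ltr0n // mulrC -ltr_pdivrMr //.
  by rewrite (lt_le_trans (truncnS_gt _)) // ler_nat ltnS.
have Mle i i' k : M i k <= M i' k.
  apply/ler_addgt0Pr => e e0; have [|K [Ke up]] := Hp' (e / 3);
    first by rewrite divr_gt0.
  have [_ _ /(_ i i' k) near _] := HMy K; move: Ke near; set t := _ / _ => Ke near.
  have := up (i, inl k); have := up (i', inl k); rewrite /u /M /= !ltr_norml; lra.
have ME i i' : M i = M i' by apply/funext => k; apply/eqP; rewrite eq_le !Mle.
have Zf i : feasible a (M i) (Z i).
  split=> [x|c].
    apply/ler_addgt0Pr => e e0; have [K [_ up]] := Hp' e e0.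
    have [_ /(_ i) o _ _] := HMy K; have := proj1 (lexmin_sub o) x.
    have := up (i, inr x); rewrite /u /Z /= ltr_norml; lra.
  apply: dot_near_eq => e e0; have [K [Ke up]] := Hp' e e0.
  exists (My K i).2 => [|x]; last exact: (up (i, inr x)).
  have [_ /(_ i) o _ _] := HMy K; rewrite (proj2 (lexmin_sub o)).
  case: c => [k|[j [k|]]]; first exact: ltW (up (i, inl k)).
    by rewrite subrr normr0 ltW.
  by rewrite subrr normr0 ltW.
have Z0 i x : 0 <= Z i x by apply: (proj1 (Zf i)).
have near e : 0 < e -> exists K, n%:R / K.+1%:R < e /\
    forall i, optimal a b (My K i).1 (My K i).2 /\
      (forall k, `|(My K i).1 k - M i k| < e) /\
      forall x, `|(My K i).2 x - Z i x| < e.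
  move=> /Hp'[K [Ke up]]; exists K; split=> // i'; have [_ o _ _] := HMy K.
  split; first exact: o.
  by split=> [k|x]; [have := up (i', inl k)|have := up (i', inr x)].
have half_move mu y y' (z : 'I_n * bool * 'I_r -> R) :
    feasible a mu y -> (forall c, dot (constr a c) z = 0) ->
    y' = (fun x => y x + 2^-1 * z x) -> (forall x, 0 <= y' x) -> feasible a mu y'.
  by move=> fy z0 -> h; apply: feasible_move.
(* Half the difference of the limits is exchanged between two nearby optima; [half_separation] keeps
   both feasible, so the difference vanishes. *)
have ZE i i' : Z i = Z i'.
  pose z x := Z i x - Z i' x.
  have zc : forall c, dot (constr a c) z = 0.
    by apply: feasible_diff (Zf i) _; rewrite (ME i i'); apply: Zf.
  have [e e0 he] := half_separation z.
  have [K [_ HK]] := near e e0.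
  have [o1 [_ n1']] := HK i; have [o2 [_ n2]] := HK i'.
  have f1 := lexmin_sub o1; have f2 := lexmin_sub o2.
  have := optimal_exchange (z := fun x => 2^-1 * z x) o1 o2.
  move=> H; apply/funext => x; apply/eqP; rewrite -subr_eq0; apply/eqP.
  suff : 2^-1 * z x = 0 by rewrite /z; lra.
  apply: H.
    apply: (half_move _ _ _ (fun x => - z x) f1) => [c||x'].
    - rewrite -[RHS]oppr0 -(zc c) -sumrN; apply: eq_bigr => v _; ring.
    - by apply/funext => v; ring.
    - by apply: near_half_sub (he x') _ (Z0 i' x') (n1' x'); apply: (proj1 f1).
  apply: (half_move _ _ _ z f2) => // x'.
  apply: near_half_add (he x') _ (Z0 i x') (n2 x'); exact: (proj1 f2).
pose i0 : 'I_n := Ordinal (ltnW n1).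
exists (M i0), (Z i0); split=> [|y' fy'|i s j k yj yk]; first exact: Zf.
  (* A nearby optimum is moved by half of [y' - Z i0]; its optimality bounds the cost of this
     direction from below. *)
  pose z x := Z i0 x - y' x.
  have zc : forall c, dot (constr a c) z = 0 by apply: feasible_diff (Zf i0) _.
  have [e e0 he] := half_separation z.
  have [K [_ HK]] := near e e0; have [o1 [_ n1']] := HK i0.
  have f1 := lexmin_sub o1.
  have f1' : feasible a (My K i0).1 (fun x => (My K i0).2 x - 2^-1 * z x).
    apply: (half_move _ _ _ (fun x => - z x) f1) => [c||x'].
    - rewrite -[RHS]oppr0 -(zc c) -sumrN; apply: eq_bigr => v _; ring.
    - by apply/funext => v; ring.
    - by apply: near_half_sub (he x') _ (proj1 fy' x') (n1' x'); apply: (proj1 f1).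
  have := lexmin_head o1 f1'.
  have -> : (fun x => (My K i0).2 x - 2^-1 * z x) =
            (fun x => (My K i0).2 x + (- 2^-1) * z x).
    by apply/funext => v; ring.
  have zE : dot (cost b) z = dot (cost b) (Z i0) - dot (cost b) y'.
    by rewrite -sumrB; apply: eq_bigr => v _; rewrite mulrBr.
  rewrite dot_comb zE; lra.
rewrite (ZE i0 i) in yj yk.
have [e [e0 ej ek]] : exists e, [/\ 0 < e, e <= Z i (i, s, j) / 2
    & e <= Z i (i, s, k) / 2].
  exists (Num.min (Z i (i, s, j)) (Z i (i, s, k)) / 2).
  by rewrite divr_gt0 ?lt_min ?yj // !ler_pM2r ?invr_gt0 // !ge_min !lexx orbT.
have [K [Ke HK]] := near e e0; have [o [nM nZ]] := HK i.
(* Positive limit weights are positive at stage [K]. The alternative of a small weight of [i] would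
   bring its limit below [2 * e], while [i] carries at least [2 * e] in part [j]. *)
have [_ _ _ /(_ i)[Mi|]] := HMy K; last first.
  by apply; [have := nZ (i, s, j)|have := nZ (i, s, k)]; rewrite ltr_norml; lra.
exfalso; have := le_lt_trans Mi Ke; have := nM i; have :=
  feasible_le i s j (Zf i); rewrite ltr_norml; lra.
Qed.

(** * The common deep point and the partition *)

Lemma common_deep_point (R : realType) (n d r : nat) (a : 'I_n -> 'rV[R]_d)
    (b : 'I_n -> R) :
    (forall i, a i != 0) -> (0 < r)%N -> (1 < n)%N ->
    ((r - 1) * (d + 1) < n)%N ->
  exists (q : 'rV[R]_d) (l : 'I_n -> option 'I_r),
    forall j, deep a b q [set i | l i == Some j].
Proof.
move=> a0 r0 n1 rn.
have [mu [y [fy ymin yuniq]]] := unsplit_optimum a b r0 n1 rn.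
have [q qside] := optimal_dual r0 fy ymin; have [y0 yc] := fy.
have [|||||l _ ldeep] :=
  @merge_parts _ _ _ _ a b q [set: 'I_r] (fun i s j => y (i, s, j)) a0.
- by move=> i s j; apply: y0.
- by move=> i s j _; apply: qside.
- by move=> i s j k _ _; apply: yuniq.
(* A part has total weight [1 / r], so it uses some hyperplane. *)
- move=> j _; apply: contrapT => no.
  have /eqP := yc (inr (j, None)); rewrite dot_part /= big1 => [|i _].
    by rewrite eq_sym invr_eq0 pnatr_eq0 eqn0Ngt r0.
  apply: big1 => s _; rewrite mul1r; apply/eqP; rewrite eq_le y0 andbT leNgt.
  by apply/negP => h; apply: no; exists i, s.
- move=> j _; apply/rowP => k; rewrite summxE [RHS]mxE.
  rewrite -[RHS](yc (inr (j, Some k))) dot_part.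
  apply: eq_bigr => i _; rewrite summxE; apply: eq_bigr => s _.
  by rewrite mxE mulrAC.
by exists q, l => j; apply: ldeep; rewrite inE.
Qed.

(* A partition of A into r parts A_1..A_r is given by a labelling
   p : 'I_n -> 'I_r, with A_j = [set i | p i == j]. *)
Theorem theorem1 (R : realType) (r d n : nat) (hr : (0 < r)%N) (hd : (0 < d)%N)
  (a : 'I_n -> 'rV[R]_d) (b : 'I_n -> R)
  (hA : arrangement a b) (hn : ((r - 1) * (d + 1) + 1 <= n)%N) :
  exists (q : 'rV[R]_d) (p : 'I_n -> 'I_r),
    forall j : 'I_r, RD_ge a b [set i | p i == j] q 1.
Proof.
case: hA => a0 _; rewrite addn1 in hn; pose j0 : 'I_r := Ordinal hr.
(* For a single part any point on a hyperplane works; the one taken is the foot of the perpendicular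
   from the origin. Larger [r] forces [1 < n], as Scarf's lemma demands. *)
have [r1|r1] := leqP r 1.
  pose i0 : 'I_n := Ordinal (leq_ltn_trans (leq0n _) hn).
  have aa : dotp (a i0) (a i0) != 0.
    apply: contra (a0 i0) => aa; apply/eqP/rowP => k; rewrite mxE.
    move: aa; rewrite psumr_eq0 => [/allP/(_ k)|l _];
      last by rewrite -expr2 sqr_ge0.
    by rewrite mem_index_enum => /(_ isT); rewrite mulf_eq0 orbb => /eqP.
  exists ((b i0 / dotp (a i0) (a i0)) *: a i0), (fun=> j0) => j.
  apply/deep_RD/(deep_on_hyp (i := i0)); last by rewrite /on_hyp dotpZr divfK.
  by rewrite inE -val_eqE /=; have := ltn_ord j; lia.
have [|q [l ldeep]] := @common_deep_point R n d r a b a0 hr _ hn.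
  by apply: leq_ltn_trans hn; rewrite muln_gt0 subn_gt0 r1 addn1.
(* Unlabelled hyperplanes join part [j0]; enlarging a part keeps it deep. *)
exists q, (fun i => odflt j0 (l i)) => j; apply: deep_RD.
by apply: deep_sub (ldeep j); apply/subsetP => i; rewrite !inE => /eqP ->.
Qed.
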